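(* Let $G$ and $H$ be two even-regular graphs (each regular, of even degree) such that each of them admits a neighborhood balanced coloring and each admits a local distance antimagic labeling. Then $\chi_{ld}(G\times H)\leq \min\{\chi_{ld}(G), \chi_{ld}(H)\}$.
   Context: All graphs are finite, simple, undirected and without isolated vertices. For a graph $G$ of order $n$ and a bijection $f\colon V(G)\to\{1,2,\dots,n\}$, the weight of a vertex $u$ is $w_f(u)=\sum_{x\in N(u)}f(x)$, where $N(u)$ is the open neighborhood of $u$. The bijection $f$ is a local distance antimagic labeling of $G$ if $w_f(u)\neq w_f(v)$ for every edge $uv$ of $G$. The local distance antimagic chromatic number $\chi_{ld}(G)$ is the minimum number of distinct weights over all local distance antimagic labelings of $G$ (an upper bound on $\chi_{ld}$ includes the assertion that such a labeling exists). A neighborhood balanced coloring of a graph is an assignment of one of two colors to each vertex (not necessarily proper) such that every vertex has equally many neighbors of each color. The direct product $G\times H$ has vertex set $V(G)\times V(H)$, with $(g,h)$ and $(g',h')$ adjacent iff $gg'\in E(G)$ and $hh'\in E(H)$. *)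

(* Defs.v *)
From mathcomp Require Import all_boot.

Set Implicit Arguments.
Unset Strict Implicit.
Unset Printing Implicit Defensive.

Record graph := Graph {
  vertex :> finType;
  adj : rel vertex;
  adj_sym : symmetric adj;
  adj_irrefl : irreflexive adj;
  no_isolated : forall u, exists v, adj u v
}.

Section Graph.
Variable G : graph.

Definition nbh (u : G) : {set G} := [set x | adj u x].

Definition even_regular := exists r : nat, ~~ odd r /\ forall u : G, #|nbh u| = r.

Definition nb_coloring (c : G -> bool) :=
  forall u : G, #|[set x in nbh u | c x]| = #|[set x in nbh u | ~~ c x]|.

Definition nb_colorable := exists c : G -> bool, nb_coloring c.

(* A labeling V(G) -> {1, ..., n} is encoded by f : V(G) -> {0, ..., n-1};
   the label of x is (f x).+1. *)
Definition weight (f : {ffun G -> 'I_#|G|}) (u : G) : nat :=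
  \sum_(x in nbh u) (f x).+1.

Definition ld_labeling (f : {ffun G -> 'I_#|G|}) : bool :=
  [&& injectiveb f,
      [forall i, exists x, f x == i]
    & [forall u, forall v, adj u v ==> (weight f u != weight f v)]].

Definition nb_weights (f : {ffun G -> 'I_#|G|}) : nat :=
  size (undup (codom (weight f))).

Definition ld_labelable := exists f, ld_labeling f.

Definition nb_weights_attained (k : nat) : bool :=
  [exists f, ld_labeling f && (nb_weights f == k)].

Lemma nb_weights_attained_ex : ld_labelable -> exists k, nb_weights_attained k.
Proof.
by case=> f Hf; exists (nb_weights f); apply/existsP; exists f; rewrite Hf /=.
Qed.

(* The minimum exists only when G has a labeling, hence the proof argument;
   the value does not depend on it. *)
Definition chi_ld (hG : ld_labelable) : nat := ex_minn (nb_weights_attained_ex hG).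

End Graph.

Section DirectProduct.
Variables G H : graph.

Definition dprod_adj : rel (G * H) := fun p q => adj p.1 q.1 && adj p.2 q.2.

Lemma dprod_adj_sym : symmetric dprod_adj.
Proof. by move=> p q; rewrite /dprod_adj adj_sym [adj p.2 _]adj_sym. Qed.

Lemma dprod_adj_irrefl : irreflexive dprod_adj.
Proof. by move=> p; rewrite /dprod_adj adj_irrefl. Qed.

Lemma dprod_no_isolated p : exists q, dprod_adj p q.
Proof.
have [g pg] := no_isolated p.1; have [h ph] := no_isolated p.2.
by exists (g, h); rewrite /dprod_adj pg ph.
Qed.

Definition direct_product : graph :=
  Graph dprod_adj_sym dprod_adj_irrefl dprod_no_isolated.

End DirectProduct.

(* Main.v *)
(* Let f be a labeling of G with values 0, ..., n-1, let c be a neighborhood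
   balanced coloring of G, and let e enumerate the m vertices of H. Label (g, h)
   by f(g) m + e(h) or by f(g) m + (m - 1 - e(h)), according to the color of g.
   Since every neighborhood in G has as many vertices of each color, the terms
   in e(h) contribute the same amount to every weight, so the weight of (g, h)
   is an increasing affine function of the weight of g. Exchanging the roles of
   G and H gives the other bound. *)
Require Import Defs.
From mathcomp Require Import all_boot zify.

Set Implicit Arguments.
Unset Strict Implicit.

Lemma chi_ld_attained (G : graph) (hG : ld_labelable G) :
  exists2 f : {ffun G -> 'I_#|G|}, ld_labeling f & nb_weights f = chi_ld hG.
Proof.
rewrite /chi_ld; case: ex_minnP => k /existsP[f /andP[fP /eqP fk]] _.
by exists f.
Qed.

Lemma chi_ld_le (G : graph) (hG : ld_labelable G) (f : {ffun G -> 'I_#|G|}) :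
  ld_labeling f -> chi_ld hG <= nb_weights f.
Proof.
move=> fP; rewrite /chi_ld; case: ex_minnP => k _; apply.
by apply/existsP; exists f; rewrite fP eqxx.
Qed.

(** Surjectivity follows from injectivity, since [G] and ['I_#|G|] have the same size. *)
Lemma ld_labelingI (G : graph) (f : {ffun G -> 'I_#|G|}) :
  injective f -> (forall u v, adj u v -> weight f u != weight f v) ->
  ld_labeling f.
Proof.
move=> f_inj fP; apply/and3P; split; first exact/injectiveP.
  apply/forallP => i; apply/existsP.
  have /codomP[x ->] : i \in codom f by apply: inj_card_onto; rewrite ?card_ord.
  by exists x.
by apply/'forall_forallP => u v; apply/implyP; apply: fP.
Qed.

Lemma ld_labeling_adj {G : graph} {f : {ffun G -> 'I_#|G|}} {u v : G} :
  ld_labeling f -> adj u v -> weight f u != weight f v.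
Proof. by case/and3P=> _ _ /'forall_forallP/(_ u v)/implyP. Qed.

(** Balance at [u] splits its neighborhood into two equal halves, on which the summand is [a] and
    [b] respectively. *)
Lemma nb_coloring_sum {G : graph} {c : G -> bool} {u : G} (a b : nat) :
  nb_coloring c ->
  \sum_(x in nbh u) (if c x then a else b) = #|nbh u|./2 * (a + b).
Proof.
move=> /(_ u) cP; rewrite (bigID c) /=.
have -> : #|nbh u| = (#|[set x in nbh u | c x]|).*2.
  rewrite -addnn {2}cP -(cardsID [set x | c x] (nbh u)); congr (_ + _).
    by apply: eq_card => x; rewrite !inE.
  by apply: eq_card => x; rewrite !inE andbC.
rewrite doubleK mulnDr {2}cP; congr (_ + _).
  rewrite -sum_nat_const; apply: eq_big => [x|x /andP[_ ->] //].
  by rewrite !inE.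
rewrite -sum_nat_const; apply: eq_big => [x|x /andP[_ /negPf->] //].
by rewrite !inE.
Qed.

(* The projections are abstract so that the roles of the two factors of a
   direct product can be exchanged. *)
Section ProductLabeling.
Variables (G H K : graph) (p : K -> G) (q : K -> H).
Hypothesis pq_bij : bijective (fun x => (p x, q x)).
Hypothesis adj_pq : forall x y, adj x y = adj (p x) (p y) && adj (q x) (q y).

Lemma product_nbh_sum (F : G -> H -> nat) (x : K) :
  \sum_(y in nbh x) F (p y) (q y) =
  \sum_(g in nbh (p x)) \sum_(h in nbh (q x)) F g h.
Proof.
rewrite pair_big /= (reindex (fun y => (p y, q y))) /=; last exact: onW_bij.
by apply: eq_bigl => y; rewrite !inE adj_pq.
Qed.

Lemma product_card : #|K| = #|G| * #|H|.
Proof. by rewrite (bij_eq_card pq_bij) card_prod. Qed.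

Variables (r s : nat) (c : G -> bool) (f : {ffun G -> 'I_#|G|}).
Hypothesis G_reg : forall u : G, #|nbh u| = r.
Hypothesis H_reg : forall u : H, #|nbh u| = s.
Hypothesis c_bal : nb_coloring c.
Hypothesis f_ld : ld_labeling f.

Let m := #|H|.

(** For a given [h], the two possible values add up to [m - 1], independently of [h]. *)
Definition product_offset (g : G) (h : H) : 'I_m :=
  if c g then enum_rank h else rev_ord (enum_rank h).

Definition product_label (x : K) : nat :=
  f (p x) * m + product_offset (p x) (q x).

Lemma product_label_lt x : product_label x < #|K|.
Proof.
rewrite product_card /product_label.
have := ltn_ord (f (p x)); have := ltn_ord (product_offset (p x) (q x)).
rewrite -/m; nia.
Qed.

(** Division by [m] recovers [f (p x)] and the offset; once [p x] is known, so is its color, and the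
    offset determines [q x]. *)
Lemma product_label_inj : injective product_label.
Proof.
move=> x y; rewrite /product_label => exy.
have m_gt0 : 0 < m by apply/card_gt0P; exists (q x).
have := congr1 (divn^~ m) exy; rewrite !divnMDl // !divn_small // !addn0.
move=> /val_inj epf; have {epf} ep : p x = p y.
  by case/and3P: f_ld => /injectiveP f_inj _ _; apply: f_inj.
move: exy; rewrite ep => /addnI/val_inj; rewrite /product_offset => eo.
have eq' : q x = q y.
  by case: (c _) eo => [|/rev_ord_inj]; apply: enum_rank_inj.
by apply: (bij_inj pq_bij); rewrite ep eq'.
Qed.

Definition product_labeling : {ffun K -> 'I_#|K|} :=
  [ffun x => Ordinal (product_label_lt x)].

(* The summand [r * (s * m)] on the left, coming from the shift between [f] and
   the labels [f + 1], avoids a truncated subtraction. *)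
Lemma product_weight x :
  weight product_labeling x + r * (s * m) =
  s * m * weight f (p x) + s * (r./2 * m.+1).
Proof.
rewrite /weight; under eq_bigr do rewrite ffunE /=.
rewrite (product_nbh_sum (fun g h => (f g * m + product_offset g h).+1)).
(* The shift is spread as one [m] per pair of neighbors, turning [f g * m] into [(f g).+1 * m]. *)
rewrite -[in r * _](G_reg (p x)) -[in _ * (s * m)]sum_nat_const.
rewrite -big_split /=.
under eq_bigr => g _.
  rewrite -[in s * m](H_reg (q x)) -sum_nat_const -big_split /=.
  rewrite (eq_bigr (fun h => (f g).+1 * m + (product_offset g h).+1)).
    rewrite big_split /= sum_nat_const H_reg; over.
  by move=> h _; rewrite mulSn addnC -addnS addnA.
rewrite big_split /= big_distrr /=; congr (_ + _).
  by apply: eq_bigr => g _; rewrite mulnCA mulnC.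
(* With [h] fixed, the sum over [g] takes two values according to color, and equals [r./2 * m.+1]
   for every [h]. *)
rewrite exchange_big /= -[in RHS](H_reg (q x)) -sum_nat_const.
apply: eq_bigr => h _.
rewrite (eq_bigr (fun g => if c g then (enum_rank h).+1
                           else (rev_ord (enum_rank h)).+1)); last first.
  by move=> g _; rewrite /product_offset; case: (c g).
rewrite (nb_coloring_sum _ _ c_bal) G_reg /=; congr (_ * _).
by have := ltn_ord (enum_rank h); rewrite -/m; lia.
Qed.

Lemma product_labeling_ld : ld_labeling product_labeling.
Proof.
apply: ld_labelingI => [x y|x y].
  by rewrite !ffunE => -[] /product_label_inj.
rewrite adj_pq => /andP[pxy qxy]; apply: contra (ld_labeling_adj f_ld pxy).
move=> /eqP exy; have := product_weight y; rewrite -exy product_weight.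
(* The slope [s * m] is positive: [q y] is a neighbor of [q x] and a vertex of [H]. *)
move=> /addIn/eqP; rewrite eqn_pmul2l // muln_gt0 -(H_reg (q x)).
by apply/andP; split; apply/card_gt0P; exists (q y); rewrite ?inE.
Qed.

Lemma product_nb_weights : nb_weights product_labeling <= nb_weights f.
Proof.
(* At [t = weight f (p x)] the subtraction is exact, by [product_weight], so every weight of the
   product labeling is the image under [phi] of a weight of [f]. *)
pose phi t := s * m * t + s * (r./2 * m.+1) - r * (s * m).
rewrite /nb_weights -[leqRHS](size_map phi); apply: uniq_leq_size (undup_uniq _) _.
move=> _ /[!mem_undup] /codomP[x ->].
apply/mapP; exists (weight f (p x)); first by rewrite mem_undup codom_f.
by rewrite /phi -product_weight addnK.
Qed.

End ProductLabeling.

Lemma product_labeling_exists (G H K : graph) (p : K -> G) (q : K -> H)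
    (ldG : ld_labelable G) :
  bijective (fun x => (p x, q x)) ->
  (forall x y, adj x y = adj (p x) (p y) && adj (q x) (q y)) ->
  even_regular G -> even_regular H -> nb_colorable G ->
  exists2 f : {ffun K -> 'I_#|K|}, ld_labeling f & nb_weights f <= chi_ld ldG.
Proof.
move=> pq_bij adj_pq [r [_ G_reg]] [s [_ H_reg]] [c c_bal].
have [f f_ld <-] := chi_ld_attained ldG.
exists (product_labeling pq_bij c f_ld); first exact: product_labeling_ld.
exact: product_nb_weights.
Qed.

Theorem theorem5p3 (G H : graph)
    (regG : even_regular G) (regH : even_regular H)
    (nbcG : nb_colorable G) (nbcH : nb_colorable H)
    (ldG : ld_labelable G) (ldH : ld_labelable H) :
  exists ldGH : ld_labelable (direct_product G H),
    chi_ld ldGH <= minn (chi_ld ldG) (chi_ld ldH).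
Proof.
pose K := direct_product G H.
have [||f f_ld f_le] :=
    @product_labeling_exists G H K fst snd ldG _ _ regG regH nbcG.
- by exists id => -[].
- by [].
have [||f' f'_ld f'_le] :=
    @product_labeling_exists H G K snd fst ldH _ _ regH regG nbcH.
- by exists (fun x => (x.2, x.1)) => -[].
- by move=> x y; rewrite andbC.
have ldK : ld_labelable K by exists f.
exists ldK; rewrite leq_min; apply/andP; split.
  exact: leq_trans (chi_ld_le ldK f_ld) f_le.
exact: leq_trans (chi_ld_le ldK f'_ld) f'_le.
Qed.
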